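(* Let $n \ge 1$ and let $T_R=([n], E_{red})$ and $T_B=([n], E_{blue})$ be two tournaments (a red one and a blue one) on the same vertex set $[n]$. Then there is a vertex $\nu \in [n]$ such that every $j\in[n]$ is reachable from $\nu$ by a rainbow directed path of length at most $2$.
   Context: $[n]=\{1,\dots,n\}$. A tournament $T=([n],E)$ is a directed graph without loops on vertex set $[n]$ such that for every two distinct vertices $i,j$ exactly one of $(i,j)$, $(j,i)$ belongs to $E$. The edges in $E_{red}$ are colored red and the edges in $E_{blue}$ are colored blue; the two tournaments are arbitrary, and a pair $(i,j)$ may be both a red edge and a blue edge. A directed path using edges of $T_R$ and $T_B$ is rainbow if its edges have pairwise different colors. Thus $j$ is reachable from $\nu$ by a rainbow directed path of length at most $2$ if and only if $j=\nu$ (path of length $0$), or $(\nu,j)\in E_{red}$, or $(\nu,j)\in E_{blue}$, or there is $k$ with $(\nu,k)\in E_{red}$ and $(k,j)\in E_{blue}$, or there is $k$ with $(\nu,k)\in E_{blue}$ and $(k,j)\in E_{red}$. *)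

(* Defs.v *)
From mathcomp Require Import all_boot.

Set Implicit Arguments.
Unset Strict Implicit.
Unset Printing Implicit Defensive.

Definition tournament (V : finType) (E : rel V) : Prop :=
  irreflexive E /\ forall i j : V, i != j -> E i j (+) E j i.

Definition color := bool.
Definition red : color := true.
Definition blue : color := false.

Definition colored_edge (V : finType) (Ered Eblue : rel V) (c : color) : rel V :=
  if c == red then Ered else Eblue.

(* A walk from x is encoded by the list of its steps (c, y): the color of the
   edge taken and the head of that edge.  The color is part of the step because
   the same pair of vertices may be both a red and a blue edge. *)
Fixpoint colored_walk (V : finType) (Ered Eblue : rel V) (x : V)
    (p : seq (color * V)) : bool :=
  if p is (c, y) :: p' then
    colored_edge Ered Eblue c x y && colored_walk Ered Eblue y p'
  else true.

Definition rainbow_path (V : finType) (Ered Eblue : rel V) (x : V)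
    (p : seq (color * V)) (y : V) : bool :=
  [&& colored_walk Ered Eblue x p,
      uniq (x :: unzip2 p),
      uniq (unzip1 p)
    & last x (unzip2 p) == y].

(* size p is the number of edges. *)
Definition rainbow_reachable (V : finType) (Ered Eblue : rel V) (k : nat)
    (x y : V) : Prop :=
  exists2 p : seq (color * V), rainbow_path Ered Eblue x p y & size p <= k.

(* Main.v *)
(* Take v maximizing the sum of the red and blue out-degrees. If j were not
   rainbow reachable from v in at most 2 steps, then j dominates v in both
   tournaments, every red out-neighbour of v is a blue out-neighbour of j, and
   every blue out-neighbour of v is a red out-neighbour of j; as v itself is an
   additional out-neighbour of j, this contradicts the choice of v. *)
Require Import Defs.
From mathcomp Require Import all_boot.

Lemma tournament_neq (V : finType) (E : rel V) (x y : V) :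
  tournament E -> E x y -> x != y.
Proof. by move=> [irrE _]; apply: contraTneq => ->; rewrite irrE. Qed.

Lemma tournament_rev (V : finType) (E : rel V) (x y : V) :
  tournament E -> x != y -> ~~ E x y -> E y x.
Proof. by move=> [_ totE] /totE; case: (E x y). Qed.

Lemma rainbow_reachable1 (V : finType) (Ered Eblue : rel V) (c : color)
    (x y : V) :
  x != y -> colored_edge Ered Eblue c x y ->
  rainbow_reachable Ered Eblue 2 x y.
Proof.
move=> nxy cxy; exists [:: (c, y)] => //.
by rewrite /rainbow_path /= cxy inE nxy eqxx.
Qed.

Lemma rainbow_reachable2 (V : finType) (Ered Eblue : rel V) (c : color)
    (x y z : V) :
  tournament Ered -> tournament Eblue -> x != z ->
  colored_edge Ered Eblue c x y -> colored_edge Ered Eblue (~~ c) y z ->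
  rainbow_reachable Ered Eblue 2 x z.
Proof.
move=> tR tB nxz cxy cyz.
have neq d u w : colored_edge Ered Eblue d u w -> u != w.
  by rewrite /colored_edge; case: ifP => _; apply: tournament_neq.
exists [:: (c, y); (~~ c, z)] => //.
rewrite /rainbow_path /= cxy cyz !inE negb_or (neq _ _ _ cxy) nxz.
by rewrite (neq _ _ _ cyz) eqxx; case: c {cxy cyz}.
Qed.

Lemma unreachable_outdegree (V : finType) (E F : rel V) (v j : V) :
  tournament E -> tournament F -> v != j -> ~~ E v j -> ~~ F v j ->
  (forall k, E v k -> ~~ F k j) -> #|E v| < #|F j|.
Proof.
move=> tE tF nvj nEvj nFvj noEF.
apply/proper_card/properP; split.
  apply/subsetP => k; rewrite !unfold_in => Evk.
  apply: tournament_rev (noEF k Evk) => //.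
  by apply: contraNneq nEvj => <-.
exists v; first by rewrite unfold_in; apply: tournament_rev nFvj.
by rewrite unfold_in tE.1.
Qed.

Theorem corollary3 (n : nat) (Ered Eblue : rel 'I_n) :
  0 < n -> tournament Ered -> tournament Eblue ->
  exists v : 'I_n, forall j : 'I_n, rainbow_reachable Ered Eblue 2 v j.
Proof.
move=> n_gt0 tR tB.
case: (@arg_maxnP _ (Ordinal n_gt0) xpredT
  (fun v => #|Ered v| + #|Eblue v|)) => // v _ vmax.
exists v => j.
have [<-|nvj] := eqVneq v j; first by exists [::]; rewrite // /rainbow_path /= eqxx.
have [Rvj|nRvj] := boolP (Ered v j); first exact: (@rainbow_reachable1 _ _ _ red).
have [Bvj|nBvj] := boolP (Eblue v j); first exact: (@rainbow_reachable1 _ _ _ blue).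
have [/existsP[k /andP[vk kj]]|noRB] := boolP [exists k, Ered v k && Eblue k j].
  exact: (@rainbow_reachable2 _ _ _ red _ k).
have [/existsP[k /andP[vk kj]]|noBR] := boolP [exists k, Eblue v k && Ered k j].
  exact: (@rainbow_reachable2 _ _ _ blue _ k).
have ltRB : #|Ered v| < #|Eblue j|.
  apply: unreachable_outdegree => // k vk.
  by apply: contraNN noRB => kj; apply/existsP; exists k; rewrite vk.
have ltBR : #|Eblue v| < #|Ered j|.
  apply: unreachable_outdegree => // k vk.
  by apply: contraNN noBR => kj; apply/existsP; exists k; rewrite vk.
have /= := vmax j isT.
by rewrite leqNgt [X in _ < X]addnC -addSn leq_add // ltnW.
Qed.
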